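(* Let $t\in\mathbb R\setminus\{0\}$. The operator $M_{q_t}$ of $\star$-multiplication on the left by $q_t$, $M_{q_t}\left(\sum_{n=0}^\infty q_t^n\alpha_n\right)=\sum_{n=0}^\infty q_t^{n+1}\alpha_n$, is a continuous Krein space isometry of $\mathbf H_{2,\circledast}^t$ into itself, and its adjoint is the backward-shift operator $$(M_{q_t}^*f)(q_t)=\sum_{n=1}^\infty q_t^{n-1}\alpha_n\qquad\text{for } f(q_t)=\sum_{n=0}^\infty q_t^n\alpha_n .$$ Moreover $M_{q_t}^*M_{q_t}f=f$ for all $f\in\mathbf H_{2,\circledast}^t$.
   Context: For $t\in\mathbb R\setminus\{0\}$, $\mathbb H_t$ is the real algebra (matrix addition and multiplication) of matrices $q_t=\begin{pmatrix}a&tb\\ \overline b&\overline a\end{pmatrix}$, $a,b\in\mathbb C$; $q_t^{\circledast}=\begin{pmatrix}\overline a&-tb\\ -\overline b&a\end{pmatrix}$, and $\|q_t\|_E=\sqrt{|a|^2+|t||b|^2}$. $\mathbf H_2^t$ is the real vector space of power series $f(q_t)=\sum_{n=0}^\infty q_t^n\alpha_n$, $\alpha_n\in\mathbb H_t$, with $\sum_n\|\alpha_n\|_E^2<\infty$, with the Hilbert space topology given by this norm. $\mathbf H_{2,\circledast}^t$ is $\mathbf H_2^t$ endowed with the real symmetric form $[f,g]_\circledast=\sum_{n=0}^\infty{\rm Tr}\,(g_n^{\circledast}f_n)$ for $f=\sum q_t^nf_n$, $g=\sum q_t^ng_n$; it is a real Krein space. Isometry means preservation of this form, and the adjoint $T^*$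 of an operator $T$ is taken with respect to it: $[Tf,g]_\circledast=[f,T^*g]_\circledast$. The $\star$-product of power series is $\left(\sum q_t^n\alpha_n\right)\star\left(\sum q_t^n\beta_n\right)=\sum_n q_t^n\sum_{k=0}^n\alpha_{n-k}\beta_k$. *)

(* Defs.v *)
From HB Require Import structures.
From mathcomp Require Import all_boot all_order all_algebra.
From mathcomp Require Import all_classical all_reals all_analysis.
From mathcomp Require Import complex.
From mathcomp Require Import ring lra.

Set Implicit Arguments.
Unset Strict Implicit.
Unset Printing Implicit Defensive.

Import Order.TTheory GRing.Theory Num.Theory numFieldNormedType.Exports.

Local Open Scope classical_set_scope.
Local Open Scope ring_scope.
Local Open Scope complex_scope.

Definition Hmx {R : realType} (t : R) (a b : R[i]) : 'M[R[i]]_2 :=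
  \matrix_(i, j) if i == 0 then (if j == 0 then a else t%:C * b)
                 else (if j == 0 then conjc b else conjc a).

Definition Hpred {R : realType} (t : R) : {pred 'M[R[i]]_2} :=
  [pred q | `[< exists a b : R[i], q = Hmx t a b >]].

Section HtClosed.
Context {R : realType} (t : R).

Lemma HmxP (q : 'M[R[i]]_2) :
  reflect (exists a b : R[i], q = Hmx t a b) (q \in Hpred t).
Proof. exact: asboolP. Qed.

Lemma Hmx_in (a b : R[i]) : Hmx t a b \in Hpred t.
Proof. by apply/HmxP; exists a, b. Qed.

Lemma Hmx_1 : 1 = Hmx t 1 0.
Proof.
apply/matrixP=> i j; rewrite !mxE.
case: i => [[|[|?]] ?] //; case: j => [[|[|?]] ?] //;
  by rewrite -!val_eqE /= ?mulr0 ?oppr0.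
Qed.

Lemma Hmx_B (a b c d : R[i]) :
  Hmx t a b - Hmx t c d = Hmx t (a - c) (b - d).
Proof.
apply/matrixP=> i j; rewrite !mxE.
by case: eqP => _; case: eqP => _; rewrite ?mulrBr ?rmorphB.
Qed.

Lemma conjcR (x : R) : conjc x%:C = x%:C.
Proof. by rewrite /= oppr0. Qed.

Lemma conjcDE (x y : R[i]) : conjc (x + y) = conjc x + conjc y.
Proof. exact: (rmorphD (@conjc R)). Qed.

Lemma conjcME (x y : R[i]) : conjc (x * y) = conjc x * conjc y.
Proof. exact: (rmorphM (@conjc R)). Qed.

Lemma Hmx_M (a b c d : R[i]) :
  Hmx t a b * Hmx t c d =
  Hmx t (a * c + t%:C * (b * conjc d)) (a * d + b * conjc c).
Proof.
apply/matrixP=> i j; rewrite -mulmxE !mxE !big_ord_recl big_ord0 !mxE.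
rewrite -!val_eqE /= addr0.
by case: eqP => _; case: eqP => _; rewrite ?conjcDE ?conjcME ?conjcK ?conjcR; ring.
Qed.

Lemma Hmx_Z (x : R) (a b : R[i]) :
  x%:C *: Hmx t a b = Hmx t (x%:C * a) (x%:C * b).
Proof.
apply/matrixP=> i j; rewrite !mxE.
by case: eqP => _; case: eqP => _; rewrite ?conjcME ?conjcR //; ring.
Qed.

Lemma Hpred_subring : subring_closed (Hpred t).
Proof.
split.
- by rewrite Hmx_1 Hmx_in.
- by move=> _ _ /HmxP[a [b ->]] /HmxP[c [d ->]]; rewrite Hmx_B Hmx_in.
- by move=> _ _ /HmxP[a [b ->]] /HmxP[c [d ->]]; rewrite Hmx_M Hmx_in.
Qed.

HB.instance Definition _ :=
  GRing.isSubringClosed.Build 'M[R[i]]_2 (Hpred t) Hpred_subring.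

Record Ht := MkHt { Hval :> 'M[R[i]]_2; HvalP : Hval \in Hpred t }.

HB.instance Definition _ := [isSub for Hval].
HB.instance Definition _ := [Choice of Ht by <:].
HB.instance Definition _ := [SubChoice_isSubNzRing of Ht by <:].

Lemma Hscale_subproof (x : R) (q : Ht) : x%:C *: Hval q \in Hpred t.
Proof. by have /HmxP[a [b ->]] := HvalP q; rewrite Hmx_Z Hmx_in. Qed.

Definition Hscale (x : R) (q : Ht) : Ht := MkHt (Hscale_subproof x q).

Lemma HscaleA x y (q : Ht) : Hscale x (Hscale y q) = Hscale (x * y) q.
Proof. by apply: val_inj; rewrite /= scalerA rmorphM. Qed.
Lemma Hscale1 : left_id 1 Hscale.
Proof. by move=> q; apply: val_inj; rewrite /= scale1r. Qed.
Lemma HscaleDr : right_distributive Hscale +%R.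
Proof. by move=> x p q; apply: val_inj; rewrite /= scalerDr. Qed.
Lemma HscaleDl (q : Ht) : {morph Hscale^~ q : x y / x + y}.
Proof. by move=> x y; apply: val_inj; rewrite /= rmorphD scalerDl. Qed.

HB.instance Definition _ :=
  GRing.Zmodule_isLmodule.Build R Ht HscaleA Hscale1 HscaleDr HscaleDl.

Lemma HscaleAl (x : R) (p q : Ht) : x *: (p * q) = (x *: p) * q.
Proof. by apply: val_inj; exact: scalerAl. Qed.
HB.instance Definition _ := GRing.Lmodule_isLalgebra.Build R Ht HscaleAl.
Lemma HscaleAr (x : R) (p q : Ht) : x *: (p * q) = p * (x *: q).
Proof. by apply: val_inj; exact: scalerAr. Qed.
HB.instance Definition _ := GRing.Lalgebra_isAlgebra.Build R Ht HscaleAr.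

(* The parameters [a] and [b] of a matrix of [Ht]; [b] is read off the
   lower-left entry, so that no division by [t] is involved. *)
Definition Ha (q : Ht) : R[i] := Hval q 0 0.
Definition Hb (q : Ht) : R[i] := conjc (Hval q 1 0).

Lemma HabE (q : Ht) : Hval q = Hmx t (Ha q) (Hb q).
Proof.
by rewrite /Ha /Hb; have /HmxP[a [b ->]] := HvalP q; rewrite !mxE /= conjcK.
Qed.

Definition Hstar (q : Ht) : Ht := MkHt (Hmx_in (conjc (Ha q)) (- Hb q)).

Definition normE (q : Ht) : R :=
  Num.sqrt (Normc.normc (Ha q) ^+ 2 + `|t| * Normc.normc (Hb q) ^+ 2).


(* [Tr] is real-valued on [Ht], so taking [Re] below loses nothing. *)
Lemma Htr_real (q : Ht) : \tr (Hval q) = (complex.Re (\tr (Hval q)))%:C.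
Proof.
rewrite HabE /mxtrace !big_ord_recl big_ord0 !mxE /= addr0.
by case: (Ha q) => x y; apply/eqP; rewrite eq_complex /= eqxx /=; apply/eqP; ring.
Qed.

Lemma normE_sqr (q : Ht) : normE q ^+ 2 =
  complex.Re (Ha q) ^+ 2 + complex.Im (Ha q) ^+ 2 + `|t| * (complex.Re (Hb q) ^+ 2 + complex.Im (Hb q) ^+ 2).
Proof.
rewrite /normE sqr_sqrtr; last by rewrite addr_ge0 ?sqr_ge0 // mulr_ge0 ?sqr_ge0 ?normr_ge0.
by case: (Ha q) => x y; case: (Hb q) => z w /=;
  rewrite !sqr_sqrtr ?addr_ge0 ?sqr_ge0.
Qed.

Definition dotE (p q : Ht) : R :=
  complex.Re (Ha p) * complex.Re (Ha q) + complex.Im (Ha p) * complex.Im (Ha q)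
  + `|t| * (complex.Re (Hb p) * complex.Re (Hb q) + complex.Im (Hb p) * complex.Im (Hb q)).

Lemma normE_sqrDZ (p q : Ht) (x : R) :
  normE (p + x *: q) ^+ 2 =
  normE p ^+ 2 + x * (2 * dotE p q) + x ^+ 2 * normE q ^+ 2.
Proof.
rewrite !normE_sqr /dotE /Ha /Hb /= !mxE.
case: (Hval p 0 0) => a1 a2; case: (Hval q 0 0) => b1 b2.
case: (Hval p 1 0) => c1 c2; case: (Hval q 1 0) => d1 d2 /=.
by ring.
Qed.

Lemma normE_sqrZ (x : R) (q : Ht) : normE (x *: q) ^+ 2 = x ^+ 2 * normE q ^+ 2.
Proof.
rewrite !normE_sqr /Ha /Hb /= !mxE.
by case: (Hval q 0 0) => b1 b2; case: (Hval q 1 0) => d1 d2 /=; ring.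
Qed.

Lemma normE_eq0 (q : Ht) : t != 0 -> normE q = 0 -> q = 0.
Proof.
move=> t0 q0; have := normE_sqr q; rewrite q0 expr0n /=.
have add0 (x y : R) : 0 <= x -> 0 <= y -> 0 = x + y -> x = 0 /\ y = 0.
  by move=> *; split; lra.
have sq0 (x y : R) : 0 = x ^+ 2 + y ^+ 2 -> x = 0 /\ y = 0.
  move=> /(add0 _ _ (sqr_ge0 _) (sqr_ge0 _))[/eqP x0 /eqP y0].
  by move: x0 y0; rewrite !sqrf_eq0 => /eqP -> /eqP ->.
move=> /add0[||/esym/sq0[a1 a2] /eqP]; rewrite ?mulr_ge0 ?addr_ge0 ?sqr_ge0 //.
rewrite mulf_eq0 normr_eq0 (negbTE t0) /= => /eqP/esym/sq0[b1 b2].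
apply: val_inj; rewrite /= HabE.
have -> : Ha q = 0 by move: a1 a2; case: (Ha q) => x y /= -> ->.
have -> : Hb q = 0 by move: b1 b2; case: (Hb q) => x y /= -> ->.
by apply/matrixP=> i j; rewrite !mxE /= oppr0 mulr0; do 2 case: eqP.
Qed.

Lemma Htr_le (p q : Ht) :
  `|complex.Re (\tr (Hval (Hstar q * p)))| <= normE p ^+ 2 + normE q ^+ 2.
Proof.
have -> : complex.Re (\tr (Hval (Hstar q * p))) =
  2 * (complex.Re (Ha p) * complex.Re (Ha q) + complex.Im (Ha p) * complex.Im (Ha q)
       - t * (complex.Re (Hb p) * complex.Re (Hb q)
              + complex.Im (Hb p) * complex.Im (Hb q))).
  rewrite /= (HabE p) Hmx_M /mxtrace !big_ord_recl big_ord0 !mxE /=.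
  case: (Ha p) => a1 a2; case: (Ha q) => b1 b2.
  by case: (Hb p) => c1 c2; case: (Hb q) => d1 d2 /=; ring.
rewrite !normE_sqr.
move: (complex.Re (Ha p)) (complex.Im (Ha p)) (complex.Re (Hb p)) (complex.Im (Hb p)).
move: (complex.Re (Ha q)) (complex.Im (Ha q)) (complex.Re (Hb q)) (complex.Im (Hb q)).
move=> b1 b2 d1 d2 a1 a2 c1 c2; rewrite ler_norml.
have s0 (x : R) : 0 <= x ^+ 2 by exact: sqr_ge0.
have := s0 (a1 - b1); have := s0 (a1 + b1); have := s0 (a2 - b2).
have := s0 (a2 + b2).
have := mulr_ge0 (normr_ge0 t) (s0 (c1 - d1)).
have := mulr_ge0 (normr_ge0 t) (s0 (c1 + d1)).
have := mulr_ge0 (normr_ge0 t) (s0 (c2 - d2)).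
have := mulr_ge0 (normr_ge0 t) (s0 (c2 + d2)).
by case: (ger0P t) => _ *; apply/andP; split; lra.
Qed.

(* A power series [\sum_n q_t^n f_n] is represented by its sequence of
   coefficients [f]. *)
Definition series_star (f g : nat -> Ht) : nat -> Ht :=
  fun n => \sum_(k < n.+1) f (n - k)%N * g k.

(* The power series [q_t]. *)
Definition series_q : nat -> Ht := fun n => (n == 1)%:R.

Definition H2pred : {pred (nat -> Ht)} :=
  [pred f | `[< cvgn (series (fun n => normE (f n) ^+ 2)) >]].

Lemma H2predP (f : nat -> Ht) :
  reflect (cvgn (series (fun n => normE (f n) ^+ 2))) (f \in H2pred).
Proof. exact: asboolP. Qed.

Definition norm2 (f : nat -> Ht) : R :=
  Num.sqrt (limn (series (fun n => normE (f n) ^+ 2))).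

Lemma norm2_ge (f : nat -> Ht) N : f \in H2pred ->
  \sum_(0 <= n < N) normE (f n) ^+ 2 <= norm2 f ^+ 2.
Proof.
move=> /H2predP cf; have h n : 0 <= normE (f n) ^+ 2 by exact: sqr_ge0.
have le : series (fun n => normE (f n) ^+ 2) N
    <= limn (series (fun n => normE (f n) ^+ 2)).
  apply: nondecreasing_cvgn_le => //.
  by apply: nondecreasing_series => n _ _.
rewrite /norm2 sqr_sqrtr //; apply: le_trans le.
by rewrite /series /= sumr_ge0.
Qed.

Lemma quad_ge0 (a b c : R) : 0 <= a -> 0 <= c ->
  (forall x, 0 <= a + x * (2 * b) + x ^+ 2 * c) -> b ^+ 2 <= a * c.
Proof.
move=> a0 c0 h; have [c_eq0|cn0] := eqVneq c 0.
  have [->|b0] := eqVneq b 0; first by rewrite expr0n mulr_ge0.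
  have := h (- (a + 1) / (2 * b)); rewrite c_eq0 mulr0 addr0 divfK; last first.
    by rewrite mulf_neq0.
  by lra.
have cp : 0 < c by rewrite lt_neqAle eq_sym cn0.
have := h (- b / c); rewrite -(pmulr_lge0 _ cp).
have -> : (a + - b / c * (2 * b) + (- b / c) ^+ 2 * c) * c = a * c - b ^+ 2.
  by field.
by rewrite subr_ge0.
Qed.

Lemma sum_normE_D (f g : nat -> Ht) N : f \in H2pred -> g \in H2pred ->
  \sum_(0 <= n < N) normE (f n + g n) ^+ 2 <= (norm2 f + norm2 g) ^+ 2.
Proof.
move=> hf hg; pose a := \sum_(0 <= n < N) normE (f n) ^+ 2.
pose c := \sum_(0 <= n < N) normE (g n) ^+ 2.
pose b := \sum_(0 <= n < N) dotE (f n) (g n).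
have E x : \sum_(0 <= n < N) normE (f n + x *: g n) ^+ 2
    = a + x * (2 * b) + x ^+ 2 * c.
  rewrite /a /b /c mulr_sumr !mulr_sumr -!big_split /=.
  by apply: eq_bigr => n _; rewrite normE_sqrDZ.
have a0 : 0 <= a by rewrite sumr_ge0 // => n _; exact: sqr_ge0.
have c0 : 0 <= c by rewrite sumr_ge0 // => n _; exact: sqr_ge0.
have hb : b ^+ 2 <= a * c.
  by apply: quad_ge0 => // x; rewrite -E sumr_ge0 // => n _; exact: sqr_ge0.
have ha := norm2_ge N hf; have hc := norm2_ge N hg; rewrite -/a -/c in ha hc.
have := E 1; rewrite expr1n !mul1r.
under eq_bigr do rewrite scale1r.
move=> ->.
have nf0 : 0 <= norm2 f by exact: sqrtr_ge0.
have ng0 : 0 <= norm2 g by exact: sqrtr_ge0.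
have bb : b <= norm2 f * norm2 g.
  apply: le_trans (ler_norm b) _.
  rewrite -(ler_pXn2r (ltn0Sn 1)) ?nnegrE ?mulr_ge0 //.
  rewrite real_normK ?num_real // exprMn.
  by apply: le_trans hb _; exact: ler_pM.
rewrite sqrrD -mulr_natl.
by lra.
Qed.

Lemma H2pred_D (f g : nat -> Ht) :
  f \in H2pred -> g \in H2pred -> f + g \in H2pred.
Proof.
move=> hf hg; apply/H2predP; apply: nondecreasing_is_cvgn.
  by apply: nondecreasing_series => n _ _; exact: sqr_ge0.
exists ((norm2 f + norm2 g) ^+ 2) => _ [N _ <-].
exact: sum_normE_D.
Qed.

Lemma normE_sqr_seriesZ (x : R) (f : nat -> Ht) :
  series (fun n => normE ((x *: f) n) ^+ 2) =
  x ^+ 2 *: series (fun n => normE (f n) ^+ 2) :> (nat -> R^o).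
Proof.
apply/funext => N; rewrite /series /=.
rewrite -[RHS]/(x ^+ 2 * \sum_(0 <= k < N) normE (f k) ^+ 2) mulr_sumr.
by apply: eq_bigr => n _; rewrite normE_sqrZ.
Qed.

Lemma H2pred_submod : submod_closed H2pred.
Proof.
split.
  apply/H2predP; rewrite (_ : series _ = cst 0); first exact: is_cvg_cst.
  apply/funext => N; rewrite /series /= big1 // => n _.
  by have := normE_sqrZ 0 0; rewrite scale0r expr0n /= mul0r.
move=> x f g /H2predP hf hg; apply: H2pred_D => //; apply/H2predP.
by rewrite normE_sqr_seriesZ; exact: is_cvgZr.
Qed.

HB.instance Definition _ :=
  GRing.isSubmodClosed.Build R (nat -> Ht) H2pred H2pred_submod.

Lemma norm2_D (f g : nat -> Ht) : f \in H2pred -> g \in H2pred ->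
  norm2 (f + g) <= norm2 f + norm2 g.
Proof.
move=> hf hg; rewrite -(ler_pXn2r (ltn0Sn 1)) ?nnegrE ?addr_ge0 ?sqrtr_ge0 //.
rewrite {1}/norm2 sqr_sqrtr; last first.
  apply: limr_ge; first by apply/H2predP; exact: H2pred_D.
  by apply: nearW => N; rewrite /series /= sumr_ge0 // => n _; exact: sqr_ge0.
apply: limr_le; first by apply/H2predP; exact: H2pred_D.
by apply: nearW => N; exact: sum_normE_D.
Qed.

Lemma norm2_Z (x : R) (f : nat -> Ht) : f \in H2pred ->
  norm2 (x *: f) = `|x| * norm2 f.
Proof.
move=> /H2predP hf; rewrite /norm2 normE_sqr_seriesZ.
rewrite (_ : limn _ = x ^+ 2 * limn (series (fun n => normE (f n) ^+ 2))).
  by rewrite sqrtrM ?sqr_ge0 // sqrtr_sqr.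
by rewrite limZr.
Qed.

Lemma norm2_eq0 (f : nat -> Ht) : t != 0 -> f \in H2pred ->
  norm2 f = 0 -> f = 0.
Proof.
move=> t0 hf f0; apply/funext => n; apply: (normE_eq0 t0).
apply/eqP; rewrite -sqrf_eq0 eq_le sqr_ge0 andbT.
have := norm2_ge n.+1 hf; rewrite f0 expr0n /= big_nat_recr //=; apply: le_trans.
by rewrite lerDr sumr_ge0 // => k _; exact: sqr_ge0.
Qed.

End HtClosed.

Arguments H2pred {R} t.
Arguments series_q {R} t.

(* The hypothesis [t != 0] is a parameter of the type because [normE] is only
   a seminorm for [t = 0]. *)
Record H2 {R : realType} {t : R} (t0 : t != 0) :=
  MkH2 { coef : nat -> Ht t; coefP : coef \in H2pred t }.

Section HardySpace.
Context {R : realType} {t : R} (t0 : t != 0).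
Local Notation H2 := (H2 t0).

HB.instance Definition _ := [isSub of H2 for @coef R t t0].
HB.instance Definition _ := [Choice of H2 by <:].
HB.instance Definition _ := [SubChoice_isSubLmodule of H2 by <:].

Definition H2norm (f : H2) : R := norm2 (coef f).

Lemma H2norm_D (f g : H2) : H2norm (f + g) <= H2norm f + H2norm g.
Proof. exact: norm2_D (coefP f) (coefP g). Qed.

Lemma H2norm_Z (x : R) (f : H2) : H2norm (x *: f) = `|x| * H2norm f.
Proof. exact: norm2_Z (coefP f). Qed.

Lemma H2norm_eq0 (f : H2) : H2norm f = 0 -> f = 0.
Proof. by move=> f0; apply: val_inj; exact: (norm2_eq0 t0 (coefP f) f0). Qed.

HB.instance Definition _ :=
  Lmodule_isNormed.Build R H2 H2norm_D H2norm_Z H2norm_eq0.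

Definition krein_form (f g : H2) : R :=
  limn (series (fun n => complex.Re (\tr (Hval (Hstar (coef g n) * coef f n))))).

Lemma krein_form_cvg (f g : H2) :
  cvgn (series (fun n => complex.Re (\tr (Hval (Hstar (coef g n) * coef f n))))).
Proof.
apply: normed_cvg.
apply: (@series_le_cvg _ _ (fun n => normE (coef f n) ^+ 2 + normE (coef g n) ^+ 2)).
- by move=> n; exact: normr_ge0.
- by move=> n; rewrite addr_ge0 ?sqr_ge0.
- by move=> n; exact: Htr_le.
- have /H2predP cf := coefP f; have /H2predP cg := coefP g.
  rewrite (_ : series _ = series (fun n => normE (coef f n) ^+ 2)
                        + series (fun n => normE (coef g n) ^+ 2)).
    exact: is_cvgD.
  by apply/funext => N; rewrite /series /= big_split.
Qed.

Definition krein_isometry (T : H2 -> H2) : Prop :=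
  forall f g, krein_form (T f) (T g) = krein_form f g.

Definition krein_adjoint (T S : H2 -> H2) : Prop :=
  forall f g, krein_form (T f) g = krein_form f (S g).

End HardySpace.

(* Main.v *)
Require Import Defs.
From HB Require Import structures.
From mathcomp Require Import all_boot all_order all_algebra.
From mathcomp Require Import all_classical all_reals all_analysis.
From mathcomp Require Import complex.
From mathcomp Require Import ring.

Set Implicit Arguments.
Unset Strict Implicit.
Unset Printing Implicit Defensive.

Import Order.TTheory GRing.Theory Num.Theory numFieldNormedType.Exports.

Local Open Scope classical_set_scope.
Local Open Scope ring_scope.

(** The forward shift only reindexes the coefficients, so it preserves the norm
    and satisfies [M f, g] = [f, B g] with [B] the backward shift; since
    [B M = 1], it is an isometry.  The adjoint is unique because the form is
    nondegenerate: composing with the fundamental symmetry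
    [(a, b) |-> (a, - sgn t * b)] turns it into twice the Hilbert inner
    product. *)

Section ShiftedSeries.
Context {R : realType}.

(** The leading zero makes the partial sum of [v] over [n.+1] terms equal to that of [u] over [n]
    terms. *)
Lemma cvg_series_delay (u v : R^nat) (l : R) : v 0 = 0 -> (forall n, v n.+1 = u n) ->
  series u @ \oo --> l -> series v @ \oo --> l.
Proof.
move=> v0 vS ul; rewrite -(cvg_shiftS (series v)).
rewrite (_ : [sequence _]_n = series u) //.
apply/funext => n; rewrite /series /= big_nat_recl // v0 add0r.
by apply: eq_bigr => i _; rewrite vS.
Qed.

Lemma is_cvg_series_advance (u : R^nat) :
  cvgn (series u) -> cvgn (series (fun n => u n.+1)).
Proof.
move=> cu; rewrite (_ : series _ = (fun n => series u n.+1 - u 0)).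
  by apply: is_cvgB; [|exact: is_cvg_cst]; apply/cvg_ex; exists (limn (series u));
     rewrite (cvg_shiftS (series u)).
by apply/funext => n; rewrite /series /= big_nat_recl // addrAC subrr add0r.
Qed.

End ShiftedSeries.

Local Open Scope complex_scope.

Section Coefficients.
Context {R : realType} (t : R).

Lemma normE0 : normE (0 : Ht t) = 0.
Proof.
by apply/eqP; rewrite -sqrf_eq0 -(scale0r (0 : Ht t)) normE_sqrZ expr0n mul0r.
Qed.

(** This is [2 * dotE p q] with the weight [|t|] of the [b] part replaced by [- t], so the form is
    indefinite for [t > 0]. *)
Lemma Re_tr_HstarE (p q : Ht t) :
  complex.Re (\tr (Hval (Hstar q * p))) =
  2 * (complex.Re (Ha p) * complex.Re (Ha q) + complex.Im (Ha p) * complex.Im (Ha q)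
       - t * (complex.Re (Hb p) * complex.Re (Hb q)
              + complex.Im (Hb p) * complex.Im (Hb q))).
Proof.
rewrite /= (HabE p) Hmx_M /mxtrace !big_ord_recl big_ord0 !mxE /=.
case: (Ha p) => a1 a2; case: (Ha q) => b1 b2.
by case: (Hb p) => c1 c2; case: (Hb q) => d1 d2 /=; ring.
Qed.

(* Rewriting with [Re_tr_HstarE] on the right-hand side makes unification unfold
   the ring structure of [Ht t] and diverge; hence the explicit [etrans]. *)
Lemma Re_tr_HstarBr (p q1 q2 : Ht t) :
  complex.Re (\tr (Hval (Hstar (q1 - q2) * p))) =
  complex.Re (\tr (Hval (Hstar q1 * p))) - complex.Re (\tr (Hval (Hstar q2 * p))).
Proof.
rewrite [LHS]Re_tr_HstarE.
apply/esym/(etrans (congr2 (fun x y => x - y) (Re_tr_HstarE p q1) (Re_tr_HstarE p q2))).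
have -> : Ha (q1 - q2) = Ha q1 - Ha q2 by rewrite /Ha /= !mxE.
have -> : Hb (q1 - q2) = Hb q1 - Hb q2 by rewrite /Hb /= !mxE rmorphB.
case: (Ha q1) => a1 a2; case: (Ha q2) => b1 b2.
by case: (Hb q1) => c1 c2; case: (Hb q2) => d1 d2 /=; ring.
Qed.

(** The fundamental symmetry on one coefficient: since [|t| = sgn t * t], the factor [- sgn t] turns
    the weight [- t] into [|t|]. *)
Definition Hsym (q : Ht t) : Ht t :=
  MkHt (Hmx_in t (Ha q) ((- Num.sg t)%:C * Hb q)).

Lemma Ha_Hsym (q : Ht t) : Ha (Hsym q) = Ha q.
Proof. by rewrite {1}/Ha /= mxE. Qed.

Lemma Hb_Hsym (q : Ht t) : Hb (Hsym q) = (- Num.sg t)%:C * Hb q.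
Proof. by rewrite {1}/Hb /= mxE /= conjcK. Qed.

Lemma normE_Hsym (q : Ht t) : t != 0 -> normE (Hsym q) ^+ 2 = normE q ^+ 2.
Proof.
move=> t0; rewrite !normE_sqr Ha_Hsym Hb_Hsym.
have s2 : Num.sg t ^+ 2 = 1 by rewrite sqr_sg t0.
case: (Hb q) => x y /=; congr (_ + _ * _); rewrite !mul0r subr0 addr0.
by rewrite !exprMn sqrrN s2 !mul1r.
Qed.

Lemma Re_tr_Hstar_Hsym (q : Ht t) :
  complex.Re (\tr (Hval (Hstar q * Hsym q))) = 2 * normE q ^+ 2.
Proof.
rewrite Re_tr_HstarE normE_sqr Ha_Hsym Hb_Hsym normrEsg.
by case: (Ha q) => a b; case: (Hb q) => x y /=; ring.
Qed.

End Coefficients.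

Section KreinForm.
Context {R : realType} {t : R} (t0 : t != 0).
Local Notation H2 := (H2 t0).

Lemma H2_ext (f g : H2) : coef f =1 coef g -> f = g.
Proof. by move=> fg; apply: val_inj; apply/funext. Qed.

Lemma krein_formBr (f g h : H2) :
  krein_form f (g - h) = krein_form f g - krein_form f h.
Proof.
rewrite /krein_form -limB; [|exact: krein_form_cvg..].
congr (limn _); apply/funext => N; apply: etrans (sumrB _ _ _ _).
by apply: eq_bigr => n _; exact: Re_tr_HstarBr.
Qed.

Lemma H2sym_subproof (f : H2) : (fun n => Hsym (coef f n)) \in H2pred t.
Proof.
apply/H2predP; under eq_fun do rewrite normE_Hsym //.
by apply/H2predP; exact: coefP.
Qed.

Lemma krein_form_nondegenerate (g : H2) :
  (forall f, krein_form f g = 0) -> g = 0.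
Proof.
(* Testing against the image of [g] under the fundamental symmetry makes the form twice the squared
   norm of [g]. *)
move=> /(_ (MkH2 t0 (H2sym_subproof g))); rewrite /krein_form /=.
under [X in series X]eq_fun do rewrite Re_tr_Hstar_Hsym.
have cg : cvgn (series (fun n => normE (coef g n) ^+ 2)).
  by apply/H2predP; exact: coefP.
rewrite (_ : series _ = 2 \*: series (fun n => normE (coef g n) ^+ 2)).
  rewrite limZr // => /eqP; rewrite mulf_eq0 pnatr_eq0 /= => /eqP g0.
  by apply: H2norm_eq0; rewrite /H2norm /norm2 g0 sqrtr0.
by apply/funext => N; rewrite /series /= -mulr_sumr.
Qed.

(** For each [g], the difference [S1 g - S2 g] is orthogonal to every [f]. *)
Lemma krein_adjoint_unique (T S1 S2 : H2 -> H2) :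
  krein_adjoint T S1 -> krein_adjoint T S2 -> S1 = S2.
Proof.
move=> TS1 TS2; apply/funext => g; apply/subr0_eq/krein_form_nondegenerate => f.
by rewrite krein_formBr -TS1 -TS2 subrr.
Qed.

End KreinForm.

Section Shifts.
Context {R : realType} {t : R} (t0 : t != 0).
Local Notation H2 := (H2 t0).

Definition delay (f : nat -> Ht t) : nat -> Ht t :=
  fun n => if n is m.+1 then f m else 0.

Lemma series_star_q (f : nat -> Ht t) : series_star (series_q t) f = delay f.
Proof.
apply/funext => -[|n]; rewrite /series_star /series_q /=.
  by rewrite big_ord1 mul0r.
(* The summand [k = n.+1] meets coefficient 0 of [q_t] and vanishes; [k = n] meets coefficient 1 and
   gives [f n]; smaller [k] meet coefficients of index at least 2, which are zero. *)
rewrite 2!big_ord_recr /= subnn mul0r addr0 subSnn mul1r big1 ?add0r // => i _.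
by rewrite subSn ?(ltnW (ltn_ord i)) // eqSS subn_eq0 leqNgt ltn_ord mul0r.
Qed.

(** Naming the limit gives at once that the shifted sequence is square summable and that its norm is
    unchanged. *)
Lemma cvg_normE_delay (f : H2) :
  series (fun n => normE (delay (coef f) n) ^+ 2) @ \oo -->
  limn (series (fun n => normE (coef f n) ^+ 2)).
Proof.
apply: (@cvg_series_delay _ (fun n => normE (coef f n) ^+ 2)) => //=.
  by rewrite normE0 expr0n.
by apply/H2predP; exact: coefP.
Qed.

Lemma shift_subproof (f : H2) : delay (coef f) \in H2pred t.
Proof. by apply/H2predP/cvg_ex; eexists; exact: cvg_normE_delay. Qed.

Definition shift (f : H2) : H2 := MkH2 t0 (shift_subproof f).

Lemma shift_is_linear : linear shift.
Proof.
move=> x f g; apply: H2_ext => -[|n] //.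
(* Only index 0 is left, where all three delayed sequences are 0. *)
by rewrite -[RHS]/(x *: (0 : Ht t) + 0) scaler0 addr0.
Qed.
HB.instance Definition _ := GRing.isLinear.Build R H2 H2 *:%R shift shift_is_linear.

Lemma bshift_subproof (f : H2) : (fun n => coef f n.+1) \in H2pred t.
Proof.
apply/H2predP.
apply: (@is_cvg_series_advance _ (fun n => normE (coef f n) ^+ 2)).
by apply/H2predP; exact: coefP.
Qed.

Definition bshift (f : H2) : H2 := MkH2 t0 (bshift_subproof f).

Lemma bshift_is_linear : linear bshift.
Proof. by move=> x f g; exact: H2_ext. Qed.
HB.instance Definition _ := GRing.isLinear.Build R H2 H2 *:%R bshift bshift_is_linear.

Lemma shiftK : cancel shift bshift.
Proof. by move=> f; exact: H2_ext. Qed.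

Lemma norm_shift (f : H2) : `|shift f| = `|f|.
Proof. by congr Num.sqrt; apply/cvg_lim => //; exact: cvg_normE_delay. Qed.

Lemma shift_continuous : continuous shift.
Proof.
apply: (@bounded_linear_continuous _ _ _ shift).
(* The shift preserves the norm, so every [r >= 1] is a bound. *)
apply/linear_boundedP; near=> r => f.
by rewrite norm_shift ler_peMl //; near: r; exact: nbhs_pinfty_ge.
Unshelve. all: by end_near. Qed.

(** Term 0 of the series for [[shift f, g]] vanishes, and its term [n.+1] is term [n] of the series
    for [[f, bshift g]]. *)
Lemma krein_adjoint_shift : krein_adjoint shift bshift.
Proof.
move=> f g; apply/cvg_lim => //.
apply: (@cvg_series_delay _ (fun n =>
  complex.Re (\tr (Hval (Hstar (coef (bshift g) n) * coef f n))))) => //.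
- by rewrite [_ * _]mulr0 mxtrace0.
- exact: krein_form_cvg.
Qed.

Lemma krein_isometry_shift : krein_isometry shift.
Proof. by move=> f g; rewrite krein_adjoint_shift shiftK. Qed.

End Shifts.

Local Close Scope complex_scope.

Theorem theorem4p5 (R : realType) (t : R) (t0 : t != 0) :
  exists Mq : {linear H2 t0 -> H2 t0},
    [/\ forall f : H2 t0, coef (Mq f) = series_star (series_q t) (coef f),
        forall (f : H2 t0) (n : nat),
          coef (Mq f) n = if n is m.+1 then coef f m else 0,
        continuous Mq,
        krein_isometry Mq &
        exists Mq_adj : {linear H2 t0 -> H2 t0},
          [/\ forall S : H2 t0 -> H2 t0, krein_adjoint Mq S <-> S = Mq_adj,
              forall (f : H2 t0) (n : nat), coef (Mq_adj f) n = coef f n.+1 &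
              forall f : H2 t0, Mq_adj (Mq f) = f]].
Proof.
exists (@shift R t t0); split.
- by move=> f; rewrite series_star_q.
- by move=> f [|n].
- exact: shift_continuous.
- exact: krein_isometry_shift.
exists (@bshift R t t0); split => //.
  move=> S; split=> [adjS|->]; last exact: krein_adjoint_shift.
  exact: krein_adjoint_unique adjS (@krein_adjoint_shift _ _ t0).
exact: shiftK.
Qed.
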